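(* For every integer $m>0$, the graph $CC_{m+2}$ does not belong to $\mathcal{F}(TW_m)$.
   Context: For an integer $k\ge 0$, $CC_k$ is the graph with vertex set $K\cup K'$, where $K=\{v_0,\dots,v_k\}$ and $K'=\{v'_0,\dots,v'_k\}$, $K$ and $K'$ are cliques, and for $0\le i,j\le k$ the vertices $v_i$ and $v'_j$ are adjacent if and only if $j<i$; there are no other edges. Given a graph $H$ with vertex set $\{h_1,\dots,h_r\}$, $r>1$, and graphs $H_1,\dots,H_r$, the graph $H[H_1,\dots,H_r]$ is obtained from the disjoint union $H_1\cup\cdots\cup H_r$ by adding all edges between $V(H_i)$ and $V(H_j)$ for every edge $h_ih_j$ of $H$. For a class of graphs $\mathcal{C}$, $\mathcal{F}(\mathcal{C})$ is the class of graphs having a factor tree with label graphs in $\mathcal{C}$, defined recursively: a single-vertex graph is in $\mathcal{F}(\mathcal{C})$, and $G\in\mathcal{F}(\mathcal{C})$ if $G=H[H_1,\dots,H_r]$ for some $H\in\mathcal{C}$ with $r=|V(H)|>1$ vertices and graphs $H_1,\dots,H_r\in\mathcal{F}(\mathcal{C})$. For an integer $m$, $TW_m$ denotes the class of graphs of treewidth at most $m$. *)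

(* Defs.v *)
From HB Require Import structures.
From mathcomp Require Import all_boot.
From mathcomp Require Import boolp.

Set Implicit Arguments.
Unset Strict Implicit.
Unset Printing Implicit Defensive.

Record sgraph := SGraph {
  vertex :> finType;
  adj : rel vertex;
  adj_sym : symmetric adj;
  adj_irr : irreflexive adj }.

Definition isomorphic (G H : sgraph) : Prop :=
  exists2 f : G -> H, bijective f & forall x y, adj (f x) (f y) = adj x y.

Section ChainOfCliques.
Variable k : nat.

(* [inl i] is $v_i$ and [inr j] is $v'_j$. *)
Definition CC_adj (x y : 'I_k.+1 + 'I_k.+1) : bool :=
  match x, y with
  | inl i, inl j | inr i, inr j => i != j
  | inl i, inr j | inr j, inl i => j < i
  end.

Lemma CC_adj_sym : symmetric CC_adj.
Proof. by move=> [i|i] [j|j] //=; rewrite eq_sym. Qed.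

Lemma CC_adj_irr : irreflexive CC_adj.
Proof. by move=> [i|i] /=; rewrite eqxx. Qed.

Definition CC : sgraph := SGraph CC_adj_sym CC_adj_irr.
End ChainOfCliques.

Section Substitution.
Variables (H : sgraph) (Hs : H -> sgraph).

Definition subst_adj (x y : {h : H & Hs h}) : bool :=
  if tag x == tag y then adj (tagged x) (tagged_as x y)
  else adj (tag x) (tag y).

Lemma subst_adj_sym : symmetric subst_adj.
Proof.
case=> [g u] [h v]; rewrite /subst_adj /= eq_sym.
case: eqP v => [-> v|_ v]; last exact: adj_sym.
by rewrite !tagged_asE adj_sym.
Qed.

Lemma subst_adj_irr : irreflexive subst_adj.
Proof. by case=> h u; rewrite /subst_adj eqxx tagged_asE adj_irr. Qed.

(* $H[H_1, \dots, H_r]$; the vertices of [H] themselves serve as indices. *)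
Definition subst_graph : sgraph := SGraph subst_adj_sym subst_adj_irr.
End Substitution.

(* Graphs are taken up to isomorphism. *)
Inductive factor_class (C : sgraph -> Prop) : sgraph -> Prop :=
| factor_single (G : sgraph) : #|G| = 1 -> factor_class C G
| factor_subst (G H : sgraph) (Hs : H -> sgraph) :
    C H -> 1 < #|H| -> (forall h, factor_class C (Hs h)) ->
    isomorphic G (subst_graph Hs) -> factor_class C G.

(* Only pairwise reachability: the empty set also qualifies. *)
Definition connected_in (G : sgraph) (A : {set G}) : Prop :=
  {in A &, forall x y, connect [rel u v in A | adj u v] x y}.

Definition acyclic (G : sgraph) : Prop :=
  forall c : seq G, 2 < size c -> ~ ucycle (@adj G) c.

Definition is_tree (T : sgraph) : Prop :=
  [/\ 0 < #|T|, connected_in [set: T] & acyclic T].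

Definition tree_decomposition (G T : sgraph) (B : T -> {set G}) : Prop :=
  [/\ is_tree T,
      forall v : G, exists t, v \in B t,
      forall u v : G, adj u v -> exists t, (u \in B t) && (v \in B t)
    & forall v : G, connected_in [set t | v \in B t]].

(* Truncated subtraction matters only for the empty graph, whose width is 0
   here rather than -1. *)
Definition width (G T : sgraph) (B : T -> {set G}) : nat :=
  \max_(t : T) #|B t| - 1.

Definition has_td_of_width (G : sgraph) (w : nat) : Prop :=
  exists (T : sgraph) (B : T -> {set G}),
    tree_decomposition B /\ width B = w.

Lemma has_td_exists (G : sgraph) : exists w, `[< has_td_of_width G w >].
Proof.
have sym1 : symmetric (fun _ _ : unit => false) by [].
have irr1 : irreflexive (fun _ _ : unit => false) by [].
pose T := SGraph sym1 irr1; pose B (_ : T) := [set: G].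
exists (width B); apply/asboolP; exists T, B; split=> //; split.
- split; first by rewrite card_unit.
  + by move=> [] [] _ _; apply: connect0.
  + by move=> [|[] [|[] c]] // _ /andP[].
- by move=> v; exists tt; rewrite inE.
- by move=> u v _; exists tt; rewrite !inE.
- by move=> v [] [] _ _; apply: connect0.
Qed.

Definition treewidth (G : sgraph) : nat := ex_minn (has_td_exists G).

Definition TW (m : nat) (G : sgraph) : Prop := treewidth G <= m.

(* Main.v *)
(** [CC k] is prime: a module containing two vertices of the clique [K] is the
    whole graph. Hence if [CC (m+2)] is [H[H_1, ..., H_r]], the vertices of [K]
    lie in distinct factors and form a clique with [m+3] vertices in [H]. A
    clique is contained in some bag of any tree decomposition, so the treewidth
    of [H] exceeds [m]. *)

Require Import Defs.
From mathcomp Require Import all_boot.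
From mathcomp Require Import boolp.

Set Implicit Arguments.
Unset Strict Implicit.
Unset Printing Implicit Defensive.

Definition del_edge (T : sgraph) (a b : T) : rel T :=
  [rel u v | adj u v && ((u, v) \notin [:: (a, b); (b, a)])].

(** A simple path from [a] to [b] avoiding the edge has an interior vertex, so the edge closes it to
    a cycle of length at least 3. *)
Lemma acyclic_bridge (T : sgraph) (a b : T) :
  acyclic T -> adj a b -> ~~ connect (del_edge a b) a b.
Proof.
move=> acT ab; apply/negP => /connectP[p0 /shortenP[p pth un _] eb].
have ne_ab : a != b by apply: contraTneq ab => ->; rewrite adj_irr.
case: p => [|c [|d p]] in pth un eb *.
- by rewrite eb eqxx in ne_ab.
- by move: pth; rewrite eb /del_edge /= mem_head andbF.
apply: (acT [:: a, c, d & p]) => //; apply/andP; split=> //.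
have : path (@adj T) a [:: c, d & p] by apply: sub_path pth => u v /andP[].
by rewrite /cycle rcons_path -eb adj_sym ab => ->.
Qed.

(** A walk inside [A] cannot use an edge with an end outside [A]. *)
Lemma connect_del_edge (T : sgraph) (a b : T) (A : {set T}) (x y : T) :
  (a \notin A) || (b \notin A) ->
  connect [rel u v in A | adj u v] x y -> connect (del_edge a b) x y.
Proof.
move=> abA; apply: connect_sub => u v /= /andP[/andP[uA vA] uv].
apply: connect1; rewrite /del_edge /= uv !inE !xpair_eqE.
case/orP: abA => nA;
  by rewrite (negPf (memPn nA _ uA)) (negPf (memPn nA _ vA)) andbF.
Qed.

Lemma del_edge_sym (T : sgraph) (a b : T) : symmetric (del_edge a b).
Proof.
move=> u v; rewrite /del_edge /= adj_sym !inE !xpair_eqE.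
by rewrite orbC (andbC (u == a)) (andbC (u == b)).
Qed.

Lemma clique_in_bag (G T : sgraph) (B : T -> {set G}) (s : seq G) :
  tree_decomposition B -> {in s &, forall x y, x != y -> adj x y} ->
  exists t, {subset s <= B t}.
Proof.
case=> -[T0 conT acT] covV covE conB.
elim: s => [|v s IHs] cl; first by case/card_gt0P: T0 => t _; exists t.
have [t st] : exists t, {subset s <= B t}.
  by apply: IHs => x y xs ys; apply: cl; rewrite inE (xs, ys) orbT.
have [r vr] := covV v.
have /connectP[p0 pth0] := conT t r (in_setT _) (in_setT _).
case/shortenP: pth0 => p pth un _ er; rewrite {r}er in vr.
(* The last vertex [t] of the path whose bag contains [s] also works for [v]:
   otherwise the next vertex [c] misses some [x \in s], and the bags of [x]
   followed by those of [v] bypass the edge [t c]. *)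
elim: p t st pth un vr => [|c p IHp] t st /=.
  by exists t => x; rewrite inE => /predU1P[->|/st].
case/andP=> /andP[_ tc] pth /andP[tp un] vr.
have [vt|nvt] := boolP (v \in B t).
  by exists t => x; rewrite inE => /predU1P[->|/st].
have [sc|] := boolP (all [in B c] s); first by apply: (IHp c) => //; apply/allP.
case/allPn=> x xs xc.
have [z /andP[xz vz]] : exists z, (x \in B z) && (v \in B z).
  apply: covE; apply: cl; rewrite ?inE ?eqxx ?xs ?orbT //.
  by apply: contraNneq nvt => <-; apply: st.
case/negP: (acyclic_bridge acT tc).
have tz : connect (del_edge t c) t z.
  apply: (@connect_del_edge _ _ _ [set u | x \in B u]).
    by rewrite !inE xc orbT.
  by apply: conB; rewrite inE // st.
have zl : connect (del_edge t c) z (last c p).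
  apply: (@connect_del_edge _ _ _ [set u | v \in B u]).
    by rewrite !inE nvt.
  by apply: conB; rewrite inE.
(* What remains is to return from [last c p] to [c] along the path, which misses [t] because it is
   simple. *)
apply: connect_trans tz (connect_trans zl _).
rewrite (sym_connect_sym (@del_edge_sym T t c)).
apply: (@connect_del_edge _ _ _ [set u in c :: p]); first by rewrite inE tp.
apply/connectP; exists p => //.
apply: (@sub_in_path _ (mem (c :: p))) pth; last exact/allP.
by move=> u w up wp /= /andP[_ uw]; rewrite !in_set up wp uw.
Qed.

Lemma clique_treewidth (G : sgraph) (S : {set G}) :
  {in S &, forall x y, x != y -> adj x y} -> #|S| <= (treewidth G).+1.
Proof.
rewrite /treewidth => cl; case: ex_minnP => w /asboolP[T [B [td <-]]] _.
have [|t St] := @clique_in_bag G T B (enum S) td.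
  by move=> x y; rewrite !mem_enum; apply: cl.
have le : #|S| <= \max_(t : T) #|B t|.
  apply: leq_trans (leq_bigmax t); apply: subset_leq_card.
  by apply/subsetP => x xS; apply: St; rewrite mem_enum.
by rewrite /width subn1; apply: leq_trans le (leqSpred _).
Qed.

Lemma factor_class_gt0 (C : sgraph -> Prop) (G : sgraph) :
  factor_class C G -> 0 < #|G|.
Proof.
elim=> {G} [G ->//|G H Hs _ H1 _ IH [f [g _ _] _]].
have /card_gt0P[h _] := ltnW H1; have /card_gt0P[x _] := IH h.
by apply/card_gt0P; exists (g (existT _ h x)).
Qed.

(* The classes of [q] are the parts of a partition into modules. *)
Lemma CC_module_full (k : nat) (I : eqType) (q : CC k -> I) (i j : 'I_k.+1) :
  (forall x y z, q x = q y -> q z != q x -> adj x z = adj y z) ->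
  i != j -> q (inl i) = q (inl j) -> forall z, q z = q (inl i).
Proof.
move=> mod; wlog ij : i j / i < j => [hw ne eq z|ne eq].
  have [ij|ji|/val_inj eij] := ltngtP i j; first exact: (hw i j).
  - by rewrite eq; apply: (hw j i); rewrite // eq_sym.
  - by rewrite eij eqxx in ne.
have split x y z : q x = q (inl i) -> q y = q (inl i) -> adj x z != adj y z ->
    q z = q (inl i).
  move=> qx qy; apply: contra_neq_eq => nz.
  by apply: mod; rewrite qx // qy.
have qi : q (inr i) = q (inl i).
  by apply: (split (inl i) (inl j)); rewrite //= ltnn ij.
have q0 : q (inl ord0) = q (inl i).
  have [->//|i0] := eqVneq i ord0.
  by apply: (split (inl i) (inr i)); rewrite //= i0.
have qk : q (inr ord_max) = q (inl i).
  apply: (split (inl i) (inr i)) => //=.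
  have ik : i < k by apply: leq_trans ij _; rewrite -ltnS.
  by rewrite -val_eqE /= neq_ltn ik /= ltnNge (ltnW ik).
(* Neither $v_0$ nor $v'_k$ has a neighbour in the opposite clique, so this pair distinguishes every
   other vertex. *)
move=> [l|l].
- have [->//|l0] := eqVneq l ord0.
  apply: (split (inl ord0) (inr ord_max)) => //=.
  by rewrite (eq_sym ord0) l0 ltnNge -ltnS ltn_ord.
- have [->//|lk] := eqVneq l ord_max.
  apply: (split (inl ord0) (inr ord_max)) => //=.
  by rewrite (eq_sym ord_max) lk ltn0.
Qed.

Theorem theorem1 (m : nat) (hm : 0 < m) : ~ factor_class (TW m) (CC m.+2).
Proof.
move=> F; case: {-1}_ / F (erefl (CC m.+2)) => [G G1 eG|].
  by move: G1; rewrite -eG card_sum !card_ord.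
move=> G H Hs twH H1 FHs iso eG; case: iso; rewrite -{G}eG => f [g fK gK] fadj.
have mod x y z : tag (f x) = tag (f y) -> tag (f z) != tag (f x) ->
    adj x z = adj y z.
  rewrite -!fadj /= /subst_adj eq_sym => eq_xy ne_xz.
  have ne_yz : tag (f y) != tag (f z) by rewrite -eq_xy.
  by rewrite (negPf ne_xz) (negPf ne_yz) eq_xy.
(* Otherwise a single factor contains all vertices; as every factor is nonempty, [H] would have only
   one vertex. *)
have inj : injective (fun i => tag (f (inl i))).
  move=> i j eq_ij; apply/eqP/negPn/negP => ne_ij.
  have full := CC_module_full mod ne_ij eq_ij.
  have all_h h : h = tag (f (inl i)).
    have /card_gt0P[x _] := factor_class_gt0 (FHs h).
    by rewrite -(full (g (existT _ h x))) gK.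
  by case/card_gt1P: H1 => a [b [_ _]]; rewrite (all_h a) (all_h b) eqxx.
(* Between distinct factors, adjacency is that of the tags in [H], so the clique $K$ carries over to
   [H]. *)
have : {in [set tag (f (inl i)) | i : 'I_m.+3] &,
    forall a b, a != b -> adj a b}.
  move=> _ _ /imsetP[i _ ->] /imsetP[j _ ->] ne.
  have := fadj (inl i) (inl j); rewrite /= /subst_adj (negPf ne) => ->.
  by apply: contraNneq ne => ->.
(* By [inj] the clique in [H] has [m.+3] vertices, so [lt_m] reads [m.+2 <= treewidth H]. *)
move/clique_treewidth; rewrite card_imset // card_ord ltnS => lt_m.
by have := leq_trans (ltnW lt_m) twH; rewrite ltnn.
Qed.
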